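(* Let $1 \in A \subset B$ be an inclusion of unital Banach algebras (with common unit). Suppose that there is an $A$-bimodule map $E\colon B \to A$ of index-finite type in the sense of Watatani; that is, for some $n \in \mathbb{N}$ there exists a quasi-basis $\{(u_i, v_i)\}_{i=1}^n$ in $B \times B$ for $E$, meaning that for all $b \in B$, $$\sum_{i=1}^n u_i E(v_i b) = b = \sum_{i=1}^n E(b u_i) v_i .$$ Then $\mathrm{ltsr}(B) \leq \mathrm{ltsr}(A) + n-1$ and $\mathrm{rtsr}(B) \leq \mathrm{rtsr}(A) + n-1$.
   Context: For a unital ring $A$, $Lg_n(A)$ (resp. $Rg_n(A)$) denotes the set of $n$-tuples of elements of $A$ which generate $A$ as a left (resp. right) ideal. For a unital Banach algebra $A$, the left (resp. right) topological stable rank $\mathrm{ltsr}(A)$ (resp. $\mathrm{rtsr}(A)$) is the least integer $n \ge 1$ such that $Lg_n(A)$ (resp. $Rg_n(A)$) is dense in $A^n$; if no such $n$ exists it is $\infty$. *)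

(* Defs.v *)
From HB Require Import structures.
From mathcomp Require Import all_boot all_order all_algebra.
From mathcomp Require Import all_classical all_reals all_analysis.

Set Implicit Arguments.
Unset Strict Implicit.
Unset Printing Implicit Defensive.

Import Order.TTheory GRing.Theory Num.Theory.
Import numFieldNormedType.Exports.

Local Open Scope classical_set_scope.
Local Open Scope ring_scope.

(* As for normed modules, the scalars are any numFieldType: K := R and
   K := R[i], for R : realType, give real and complex Banach algebras.
   Algebras are associative, unital and nonzero; the norm of the unit is not
   required to be 1.
   The ring operations are fields of the mixin, rather than inherited from
   algType, because MathComp has no join of nzRingType with normed modules
   below numDomainType; the algType structure is installed right after. *)
HB.mixin Record CompleteNormedModule_isBanachAlgebra (K : numFieldType) A
    of CompleteNormedModule K A := {
  ba_one : A;
  ba_mul : A -> A -> A;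
  ba_mulA : associative ba_mul;
  ba_mul1l : left_id ba_one ba_mul;
  ba_mul1r : right_id ba_one ba_mul;
  ba_mulDl : left_distributive ba_mul +%R;
  ba_mulDr : right_distributive ba_mul +%R;
  ba_oner_neq0 : ba_one != 0;
  ba_scaleAl : forall (k : K) (x y : A), k *: ba_mul x y = ba_mul (k *: x) y;
  ba_scaleAr : forall (k : K) (x y : A), k *: ba_mul x y = ba_mul x (k *: y);
  ba_normM_le : forall x y : A, `|ba_mul x y| <= `|x| * `|y|
}.

#[short(type="banachAlgType")]
HB.structure Definition BanachAlgebra (K : numFieldType) :=
  {A of CompleteNormedModule K A & CompleteNormedModule_isBanachAlgebra K A}.

#[non_forgetful_inheritance]
HB.instance Definition _ (K : numFieldType) (A : banachAlgType K) :=
  GRing.Zmodule_isNzRing.Build (BanachAlgebra.sort A) (@ba_mulA K A)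
    (@ba_mul1l K A) (@ba_mul1r K A) (@ba_mulDl K A) (@ba_mulDr K A)
    (@ba_oner_neq0 K A).

#[non_forgetful_inheritance]
HB.instance Definition _ (K : numFieldType) (A : banachAlgType K) :=
  GRing.LSemiModule_isLSemiAlgebra.Build K (BanachAlgebra.sort A) (@ba_scaleAl K A).

#[non_forgetful_inheritance]
HB.instance Definition _ (K : numFieldType) (A : banachAlgType K) :=
  GRing.LSemiAlgebra_isSemiAlgebra.Build K (BanachAlgebra.sort A) (@ba_scaleAr K A).

Lemma normrM_le (K : numFieldType) (A : banachAlgType K) (x y : A) :
  `|x * y| <= `|x| * `|y|.
Proof. exact: ba_normM_le. Qed.

Section Generation.
Context {A : nzRingType}.

(* Closure under opposites follows by multiplying with -1. *)
Definition left_ideal (I : set A) : Prop :=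
  [/\ I 0, (forall x y, I x -> I y -> I (x + y))
    & (forall a x, I x -> I (a * x))].

Definition right_ideal (I : set A) : Prop :=
  [/\ I 0, (forall x y, I x -> I y -> I (x + y))
    & (forall x a, I x -> I (x * a))].

End Generation.

Definition Lg (A : nzRingType) (n : nat) : set 'rV[A]_n :=
  [set a | smallest left_ideal (range (fun i => a 0 i)) = setT].

Definition Rg (A : nzRingType) (n : nat) : set 'rV[A]_n :=
  [set a | smallest right_ideal (range (fun i => a 0 i)) = setT].

Definition least_or_infty (P : set nat) : \bar int :=
  if pselect (exists n, `[< P n >]) is left exP then (ex_minn exP)%:Z%:E
  else +oo%E.

(* The topology on 'rV[A]_n is the product topology. *)
Definition ltsr (K : numFieldType) (A : banachAlgType K) : \bar int :=
  least_or_infty [set n | (1 <= n)%N /\ dense (@Lg A n)].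

Definition rtsr (K : numFieldType) (A : banachAlgType K) : \bar int :=
  least_or_infty [set n | (1 <= n)%N /\ dense (@Rg A n)].

Section Inclusion.
Context {K : numFieldType} {A B : banachAlgType K}.

(* A is identified with its image under the unital algebra morphism iota;
   being isometric, iota is injective with closed image. *)
Definition banach_inclusion (iota : {lrmorphism A -> B}) : Prop :=
  forall a : A, `|iota a| = `|a|.

Definition bimodule_map (iota : A -> B) (E : B -> A) : Prop :=
  [/\ (forall b c, E (b + c) = E b + E c),
      (forall a b, E (iota a * b) = a * E b)
    & (forall b a, E (b * iota a) = E b * a)].

Definition quasi_basis (iota : A -> B) (E : B -> A) (n : nat)
    (u v : 'I_n -> B) : Prop :=
  forall b : B, \sum_(i < n) u i * iota (E (v i * b)) = b
             /\ b = \sum_(i < n) iota (E (b * u i)) * v i.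

End Inclusion.

(* Main.v *)
Require Import Defs.
From HB Require Import structures.
From mathcomp Require Import all_boot all_order all_algebra.
From mathcomp Require Import all_classical all_reals all_analysis.

Set Implicit Arguments.
Unset Strict Implicit.
Unset Printing Implicit Defensive.

Import Order.TTheory GRing.Theory Num.Theory.
Import numFieldNormedType.Exports.

Local Open Scope classical_set_scope.
Local Open Scope ring_scope.

(** The second quasi-basis identity says that [v_1, ..., v_n] generate [B] as
    a left [A]-module: every column [b] over [B] is a product [M v] for some
    matrix [M] over [A]. If [M'] is a matrix over [A] close to [M] with a left
    inverse [L], then [b' = M' v] is close to [b], and [L b' = v]. Since [1]
    is itself a combination of the [v_i], the entries of [b'] generate [B] as
    a left ideal.

    It remains to approximate matrices over [A] by left invertible ones. If
    the columns of length [m] that generate [A] as a left ideal are dense,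
    then left invertible [p x n] matrices are dense for every
    [p >= m + n - 1] ([left_invertible_dense]). The proof is by induction on
    [n] and is due in essence to Rieffel: since the first column may be assumed
    to have a generating part avoiding the first row, elementary row operations
    turn it into the first unit vector, and the induction hypothesis is applied
    to the remaining block.

    The statement on right ideals is the one on left ideals for the converse
    rings. To use a single argument for both, everything is proved for a ring
    with a submultiplicative seminorm, a notion that is visibly invariant under
    reversing the multiplication. *)

(** * Submultiplicative seminorms and dense sets of matrices *)

Record ring_seminorm (K : numFieldType) (R : nzRingType) (nu : R -> K) :
    Prop := RingSeminorm {
  seminorm0 : nu 0 = 0;
  seminorm_ge0 : forall x, 0 <= nu x;
  seminormD : forall x y, nu (x + y) <= nu x + nu y;
  seminormM : forall x y, nu (x * y) <= nu x * nu y }.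

(** Density for the topology of entrywise convergence, which is defined without
    a topological structure on [R], so that it applies to converse rings. *)
Definition seminorm_dense (K : numFieldType) (R : nzRingType) (nu : R -> K)
    (p n : nat) (S : set 'M[R]_(p, n)) : Prop :=
  forall (M : 'M[R]_(p, n)) (e : K), 0 < e ->
    exists2 M', S M' & forall i j, nu (M' i j - M i j) < e.

Definition left_invertible (R : nzRingType) (p n : nat) : set 'M[R]_(p, n) :=
  [set M | exists L : 'M[R]_(n, p), L *m M = 1%:M].

Section Seminorm.
Context {K : numFieldType} {R : nzRingType} {nu : R -> K}.
Hypothesis nuP : ring_seminorm nu.

Lemma seminorm_sum (I : finType) (F : I -> R) :
  nu (\sum_i F i) <= \sum_i nu (F i).
Proof.
elim/big_ind2: _ => [|x1 x2 y1 y2 le1 le2|//]; first by rewrite (seminorm0 nuP).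
exact: le_trans (seminormD nuP _ _) (lerD le1 le2).
Qed.

Lemma exists_small_factor (C e : K) : 0 <= C -> 0 < e ->
  exists2 d, 0 < d & C * d < e.
Proof.
move=> C_ge0 e_gt0; have C1_gt0 : 0 < C + 1 by rewrite ltr_wpDl.
exists (e / (C + 1)); first exact: divr_gt0.
by rewrite mulrCA gtr_pMr // ltr_pdivrMr // mul1r ltrDl.
Qed.

Lemma seminorm_mulmx_left (q p n : nat) (S : 'M[R]_(q, p)) (e : K) : 0 < e ->
  exists2 d, 0 < d & forall D : 'M[R]_(p, n), (forall i j, nu (D i j) < d) ->
    forall i j, nu ((S *m D) i j) < e.
Proof.
move=> e_gt0; pose C := \sum_i \sum_k nu (S i k).
have row_ge0 i : 0 <= \sum_k nu (S i k).
  by apply: sumr_ge0 => k _; apply: (seminorm_ge0 nuP).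
have [||d d_gt0 ltCd] := @exists_small_factor C e => //; first exact: sumr_ge0.
exists d => // D ltD i j; apply: le_lt_trans ltCd.
rewrite mxE; apply: le_trans (seminorm_sum _) _.
have row_le : \sum_k nu (S i k) <= C
  by rewrite /C [leRHS](bigD1 i) //= lerDl sumr_ge0.
apply: le_trans (ler_wpM2r (ltW d_gt0) row_le).
rewrite mulr_suml; apply: ler_sum => k _; apply: le_trans (seminormM nuP _ _) _.
exact: ler_wpM2l (seminorm_ge0 nuP _) _ _ (ltW (ltD _ _)).
Qed.

Lemma seminorm_mulmx_right (q p n : nat) (S : 'M[R]_(p, n)) (e : K) : 0 < e ->
  exists2 d, 0 < d & forall D : 'M[R]_(q, p), (forall i j, nu (D i j) < d) ->
    forall i j, nu ((D *m S) i j) < e.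
Proof.
move=> e_gt0; pose C := \sum_j \sum_k nu (S k j).
have col_ge0 j : 0 <= \sum_k nu (S k j).
  by apply: sumr_ge0 => k _; apply: (seminorm_ge0 nuP).
have [||d d_gt0 ltCd] := @exists_small_factor C e => //; first exact: sumr_ge0.
exists d => // D ltD i j; apply: le_lt_trans ltCd.
rewrite mxE; apply: le_trans (seminorm_sum _) _.
have col_le : \sum_k nu (S k j) <= C
  by rewrite /C [leRHS](bigD1 j) //= lerDl sumr_ge0.
apply: le_trans (ler_wpM2r (ltW d_gt0) col_le).
rewrite mulrC mulr_sumr; apply: ler_sum => k _.
apply: le_trans (seminormM nuP _ _) _.
exact: ler_wpM2r (seminorm_ge0 nuP _) _ _ (ltW (ltD _ _)).
Qed.

Lemma seminorm_dense_col_mx (q p n : nat) (S : set 'M[R]_(p, n))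
    (T : set 'M[R]_(q + p, n)) :
  (forall U D, S D -> T (col_mx U D)) ->
  seminorm_dense nu S -> seminorm_dense nu T.
Proof.
move=> ST dS M e e_gt0; have [D SD ltD] := dS (dsubmx M) e e_gt0.
exists (col_mx (usubmx M) D) => [|i j]; first exact: ST.
rewrite -{2}(vsubmxK M); case: (split_ordP i) => k ->.
  by rewrite !col_mxEu subrr (seminorm0 nuP).
by rewrite !col_mxEd; apply: ltD.
Qed.

(** * Density of left invertible matrices *)

Lemma left_invertible_col_mx (q p n : nat) (U : 'M[R]_(q, n))
    (D : 'M[R]_(p, n)) : left_invertible D -> left_invertible (col_mx U D).
Proof.
by case=> L LD; exists (row_mx 0 L); rewrite mul_row_col mul0mx add0r.
Qed.

Lemma left_invertible_col_dense (m p : nat) : (m <= p)%N ->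
  seminorm_dense nu (@left_invertible R m 1) ->
  seminorm_dense nu (@left_invertible R p 1).
Proof.
move=> /subnK <- dm; apply: seminorm_dense_col_mx dm => U D.
exact: left_invertible_col_mx.
Qed.

(** Row reduction: adding [(1 - a) r] times the lower rows to the first row
    turns [a] into [1], which serves as a pivot to clear [c]. The lower right
    block then becomes the matrix assumed to be left invertible. *)
Lemma left_invertible_block_mx (p n : nat) (a : 'M[R]_1) (w : 'M[R]_(1, n))
    (c : 'M[R]_(p, 1)) (N : 'M[R]_(p, n)) (r : 'M[R]_(1, p)) :
  r *m c = 1%:M ->
  left_invertible (N - c *m (w + (1%:M - a) *m r *m N)) ->
  left_invertible (block_mx a w c N).
Proof.
move=> rc; set s := (1%:M - a) *m r; set w1 := w + _ => -[L LN].
have pivot : row_mx 1%:M s *m block_mx a w c N = row_mx 1%:M w1.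
  by rewrite mul_row_block !mul1mx -mulmxA rc mulmx1 addrC subrK.
(* [Z] eliminates [c] with the pivot row, then applies [L] to what remains. *)
pose Z := L *m (row_mx 0 1%:M - c *m row_mx 1%:M s).
have ZM : Z *m block_mx a w c N = row_mx 0 1%:M.
  rewrite -mulmxA mulmxBl -(mulmxA c) pivot mul_row_block !mul0mx !mul1mx !add0r.
  by rewrite mul_mx_row mulmx1 opp_row_mx add_row_mx subrr mul_mx_row mulmx0 LN.
exists (col_mx (row_mx 1%:M s - w1 *m Z) Z).
rewrite mul_col_mx mulmxBl pivot -mulmxA ZM mul_mx_row mulmx0 mulmx1.
by rewrite opp_row_mx add_row_mx oppr0 addr0 subrr -block_mxEv -scalar_mx_block.
Qed.

(** In the inductive step, one row is set aside: the rest of the first column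
    still has at least [m] entries and is perturbed first. The reduced block is
    then perturbed by [D]. Undoing the row operations, this amounts to adding
    [D] to the lower right block of the original matrix and the small row
    [- (1 - a) r D] to the upper right one, where [a] is the top left entry and
    [r] is a left inverse of the perturbed column. *)
Lemma left_invertible_dense (m n p : nat) : (m + n <= p)%N ->
  seminorm_dense nu (@left_invertible R m 1) ->
  seminorm_dense nu (@left_invertible R p n.+1).
Proof.
move=> + dm; elim: n p => [|n IHn] p.
  by rewrite addn0 => /left_invertible_col_dense; apply.
case: p => [|p]; first by rewrite addnS.
rewrite addnS ltnS => le_mn_p M e e_gt0.
have le_mp : (m <= p)%N := leq_trans (leq_addr _ _) le_mn_p.
have [a [w [c [N defM]]]] : exists a w c N,
    M = @block_mx R 1 p 1 n.+1 a w c N.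
  by do 4!eexists; rewrite -[LHS](@submxK R 1 p 1 n.+1).
have [c' [r rc'] ltc] := left_invertible_col_dense le_mp dm c e_gt0.
pose s := (1%:M - a) *m r.
(* The scalars need not be totally ordered: stacking the two factors gives a
   single [d] that controls both [D] and [- s *m D], without a minimum. *)
have [d d_gt0 ltsD] :=
  seminorm_mulmx_left n.+1 (col_mx (1%:M : 'M[R]_p) (- s)) e_gt0.
pose N1 := N - c' *m (w + s *m N).
have [N2 invN2 ltN2] := IHn p le_mn_p N1 d d_gt0.
pose D := N2 - N1.
have ltSD i j : nu (col_mx D (- s *m D) i j) < e.
  rewrite -{1}(mul1mx D) -mul_col_mx; apply: ltsD => i1 j1.
  by have := ltN2 i1 j1; rewrite [D _ _]mxE [(- N1) _ _]mxE.
exists (block_mx a (w - s *m D) c' (N + D)).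
  apply: (@left_invertible_block_mx p n.+1 _ _ _ _ r) => //.
  have -> : w - s *m D + (1%:M - a) *m r *m (N + D) = w + s *m N.
    by rewrite -/s (mulmxDr s N D) addrA addrAC subrK.
  by rewrite addrAC -/N1 /D addrC subrK.
rewrite defM.
change (forall (i : 'I_(1 + p)) (j : 'I_(1 + n.+1)),
  nu (block_mx a (w - s *m D) c' (N + D) i j - block_mx a w c N i j) < e).
move=> i j; case: (split_ordP i) => k ->; case: (split_ordP j) => l ->.
- by rewrite !block_mxEul subrr (seminorm0 nuP).
- rewrite !block_mxEur; move: (ltSD (rshift p k) l).
  by rewrite col_mxEd mulNmx !mxE addrAC subrr add0r.
- by rewrite !block_mxEdl; apply: ltc.
rewrite !block_mxEdr [(N + D) k l]mxE addrAC subrr add0r.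
by have := ltSD (lshift 1 k) l; rewrite col_mxEu.
Qed.

End Seminorm.

(** * Extensions generated by finitely many elements *)

(** Writing a column over [S] as a matrix over [R] times [v], one perturbs only
    the matrix; a left inverse of it over [R] recovers [v], hence [1]. *)
Lemma left_invertible_col_extension_dense (K : numFieldType)
    (R S : nzRingType) (nu : R -> K) (mu : S -> K) (f : {rmorphism R -> S})
    (n : nat) (v : 'cV[S]_n.+1) (coord : S -> 'rV[R]_n.+1) (m p : nat) :
  ring_seminorm nu -> ring_seminorm mu -> (forall x, mu (f x) <= nu x) ->
  (forall b, map_mx f (coord b) *m v = b%:M) -> (m + n <= p)%N ->
  seminorm_dense nu (@left_invertible R m 1) ->
  seminorm_dense mu (@left_invertible S p 1).
Proof.
move=> nuP muP le_mu coordK le_mn_p dm b e e_gt0.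
pose M : 'M[R]_(p, n.+1) := \matrix_(j, i) coord (b j 0) 0 i.
have defb : b = map_mx f M *m v.
  apply/colP => j; have /matrixP/(_ 0 0) := coordK (b j 0).
  by rewrite !mxE eqxx mulr1n => <-; apply: eq_bigr => i _; rewrite !mxE.
have [d d_gt0 ltd] := seminorm_mulmx_right muP p v e_gt0.
have [M' [L LM'] ltM'] := left_invertible_dense nuP le_mn_p dm M d_gt0.
exists (map_mx f M' *m v).
  exists (map_mx f (coord 1) *m map_mx f L).
  by rewrite -mulmxA (mulmxA (map_mx f L)) -map_mxM LM' map_mx1 mul1mx coordK.
move=> i j; rewrite defb.
have -> : (map_mx f M' *m v) i j - (map_mx f M *m v) i j =
    (map_mx f (M' - M) *m v) i j by rewrite map_mxB mulmxBl !mxE.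
apply: ltd => i1 j1; rewrite mxE; apply: le_lt_trans (le_mu _) _.
by have := ltM' i1 j1; rewrite [(M' - M) _ _]mxE [(- M) _ _]mxE.
Qed.

(** * Left ideals in a ring and in its converse *)

(** The elements [x] with [x = L a] for some row [L] form a left ideal that
    contains the entries of [a], hence is everything as soon as they generate;
    taking [x = 1] gives a left inverse. *)
Lemma Lg_left_invertible (R : nzRingType) (n : nat) (a : 'rV[R]_n) :
  Lg a <-> left_invertible a^T.
Proof.
split=> [aT|[L La]].
  pose I : set R := [set x | exists L : 'rV_n, L *m a^T = x%:M].
  have I_ideal : left_ideal I.
    split=> [|x y [Lx Hx] [Ly Hy]|c x [L Lx]].
    - by exists 0; rewrite mul0mx raddf0.
    - by exists (Lx + Ly); rewrite mulmxDl Hx Hy raddfD.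
    - by exists (c *: L); rewrite -scalemxAl Lx scale_scalar_mx.
  have : smallest left_ideal (range (fun i => a 0 i)) 1 by rewrite aT.
  move=> /(_ I); apply; split=> // _ [i _ <-]; exists (delta_mx 0 i).
  by rewrite -rowE; apply/rowP => j; rewrite !mxE !ord1 eqxx mulr1n.
rewrite /Lg /= -subTset => x _ I [[I0 ID IM] aI].
have -> : x = \sum_i x * L 0 i * a 0 i.
  have /matrixP/(_ 0 0) := La; rewrite !mxE eqxx => Lax.
  rewrite -[LHS]mulr1 -[1]Lax mulr_sumr.
  by apply: eq_bigr => i _; rewrite mxE mulrA.
by elim/big_ind: _ => // i _; apply: IM; apply: aI; exists i.
Qed.

Lemma Rg_converse (R : nzRingType) (n : nat) : @Rg R n = @Lg R^c n.
Proof.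
suff eqI : @right_ideal R = @left_ideal R^c by rewrite /Rg /Lg eqI.
by apply/funext => I; apply/propext; split=> -[I0 ID IM]; split=> // x a;
  apply: IM.
Qed.

Definition converse_morphism (R S : nzRingType) (f : {rmorphism R -> S}) :
  R^c -> S^c := f.

HB.instance Definition _ (R S : nzRingType) (f : {rmorphism R -> S}) :=
  GRing.isZmodMorphism.Build R^c S^c (converse_morphism f) (rmorphB f).

Fact converse_morphism_monoid (R S : nzRingType) (f : {rmorphism R -> S}) :
  monoid_morphism (converse_morphism f).
Proof. by split=> [|x y]; [exact: (rmorph1 f) | exact: (rmorphM f y x)]. Qed.

HB.instance Definition _ (R S : nzRingType) (f : {rmorphism R -> S}) :=
  GRing.isMonoidMorphism.Build R^c S^c (converse_morphism f)
    (converse_morphism_monoid f).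

Lemma converse_seminorm (K : numFieldType) (R : nzRingType) (nu : R -> K) :
  ring_seminorm nu -> @ring_seminorm K R^c nu.
Proof.
case=> nu0 nu_ge0 nuD nuM; split=> // x y.
by rewrite mulrC; apply: nuM.
Qed.

(** * Banach algebras *)

Section BanachAlgebra.
Context {K : numFieldType} {A : banachAlgType K}.

Lemma normr_seminorm : @ring_seminorm K A Num.norm.
Proof.
by split=> [|//|x y|x y]; [apply: normr0 | apply: ler_normD | apply: normrM_le].
Qed.

Lemma dense_seminorm_dense (n : nat) (S : set 'rV[A]_n) :
  dense S <->
  @seminorm_dense K A Num.norm n 1 [set M : 'cV[A]_n | S M^T].
Proof.
split=> [dS M e e_gt0|dS O [x Ox] oO].
  have [|x []] := dS (interior (ball M^T e)) _ (open_interior _).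
    by exists M^T; apply: nbhsx_ballx.
  move=> /interior_subset /= xe Sx.
  exists x^T => [/=|i j]; first by rewrite trmxK.
  by have := xe.2 j i; rewrite -ball_normE /= distrC !mxE.
have /nbhs_ballP[e /= e_gt0 eO] : nbhs x O by apply: open_nbhs_nbhs.
have [M SM ltM] := dS x^T e e_gt0; exists M^T.
split=> //; apply: eO; split=> // i j.
by rewrite -ball_normE /= distrC; have := ltM j i; rewrite !mxE.
Qed.

Lemma dense_Lg (n : nat) :
  dense (@Lg A n) <->
  @seminorm_dense K A Num.norm n 1 (@left_invertible A n 1).
Proof.
rewrite dense_seminorm_dense.
suff -> : [set M : 'cV[A]_n | Lg M^T] = @left_invertible A n 1 by [].
by apply/seteqP; split=> M /=; rewrite Lg_left_invertible trmxK.
Qed.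

Lemma dense_Rg (n : nat) :
  dense (@Rg A n) <->
  @seminorm_dense K A^c Num.norm n 1 (@left_invertible A^c n 1).
Proof.
rewrite dense_seminorm_dense Rg_converse.
suff -> : [set M : 'cV[A]_n | @Lg A^c n M^T] = @left_invertible A^c n 1 by [].
by apply/seteqP; split=> M /=; rewrite Lg_left_invertible trmxK.
Qed.

End BanachAlgebra.

Lemma least_or_infty_leD (P Q : set nat) (n : nat) :
  (forall m, P m -> Q (m + n)%N) ->
  (least_or_infty Q <= least_or_infty P + n%:Z%:E)%E.
Proof.
move=> PQ; rewrite {2}/least_or_infty; case: pselect => [exP|_]; last first.
  by rewrite addye // leey.
case: ex_minnP => m /asboolP Pm _; rewrite /least_or_infty.
case: pselect => [exQ|[]]; last by exists (m + n)%N; apply/asboolP/PQ.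
case: ex_minnP => k _ /(_ (m + n)%N); rewrite -EFinD lee_fin -PoszD lez_nat.
by apply; apply/asboolP/PQ.
Qed.

Theorem theorem2p11 (K : numFieldType) (A B : banachAlgType K)
    (iota : {lrmorphism A -> B}) (E : B -> A) (n : nat) (u v : 'I_n -> B) :
  banach_inclusion iota ->
  bimodule_map iota E ->
  quasi_basis iota E u v ->
  (ltsr B <= ltsr A + (n%:Z - 1)%:E)%E /\
  (rtsr B <= rtsr A + (n%:Z - 1)%:E)%E.
Proof.
move=> iotaI _ uvP; case: n u v uvP => [|n] u v uvP.
  (* An empty quasi-basis would force [1 = 0] in [B]. *)
  by have [_ /eqP] := uvP 1; rewrite big_ord0 oner_eq0.
have -> : n.+1%:Z - 1 = n%:Z by rewrite -addn1 PoszD addrK.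
have le_iota x : `|iota x| <= `|x| by rewrite iotaI.
split; apply: least_or_infty_leD => m [m_gt0 dm]; split;
    rewrite ?ltn_addr //.
  apply/dense_Lg; move/dense_Lg: dm.
  apply: (@left_invertible_col_extension_dense K A B _ _ iota n
            (\col_i v i) (fun b => \row_i E (b * u i))) => //.
  - exact: normr_seminorm.
  - exact: normr_seminorm.
  move=> b; apply/matrixP => i j; rewrite !ord1 !mxE eqxx mulr1n.
  by rewrite [RHS](uvP b).2; apply: eq_bigr => k _; rewrite !mxE.
(* In the converse rings the first quasi-basis identity takes the place of the
   second one, with the roles of [u] and [v] exchanged. *)
apply/dense_Rg; move/dense_Rg: dm.
apply: (@left_invertible_col_extension_dense K A^c B^c _ _
          (converse_morphism iota) n
          (\col_i u i) (fun b => \row_i E (v i * b))) => //.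
- exact/converse_seminorm/normr_seminorm.
- exact/converse_seminorm/normr_seminorm.
move=> b; apply/matrixP => i j; rewrite !ord1 !mxE eqxx mulr1n.
by rewrite -[RHS](uvP b).1; apply: eq_bigr => k _; rewrite !mxE.
Qed.
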